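(* The Pauli group $P(1)$ is natural: there is a metric space which admits only one group operation, that of $P(1)$, on its underlying set up to relabeling. That is, there is a metric space $X$ carrying a group structure $(X,* )$ isomorphic to $P(1)$ for which the group multiplications and inversions are isometries of $X$, and up to relabeling this is the only group operation that the metric space admits on its underlying set.
   Context: The Pauli group $P(1)$ is the non-Abelian group of order $16$ generated under matrix multiplication by the Pauli matrices $$X=\begin{pmatrix}0&1\\1&0\end{pmatrix},\qquad Y=\begin{pmatrix}0&-i\\ i&0\end{pmatrix},\qquad Z=\begin{pmatrix}1&0\\0&-1\end{pmatrix}.$$ A group $(G,+)$ is called natural if there exists a metric space $X$ which carries a group structure $(X,* )$ such that $(G,+)$ and $(X,* )$ are isomorphic groups and so that the group multiplications and inversions are isometries of $X$. A metric space admits a group operation on its underlying set if the group multiplications and inversions of that operation are isometries of the metric space. (In the claim the letter $X$ denotes the metric space, not the Pauli matrix.)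
   Formalization: ''Group multiplications and inversions are isometries'' is read as: left translations by each element and by its inverse are isometries; the map sending x to its inverse need not be an isometry, since requiring it would make uniqueness false for the Pauli group. *)

(* Defs.v *)
From HB Require Import structures.
From mathcomp Require Import all_boot all_order all_algebra.
From mathcomp Require Import complex.
From mathcomp Require Import all_classical all_reals all_analysis.

Set Implicit Arguments.
Unset Strict Implicit.
Unset Printing Implicit Defensive.

Import Order.TTheory GRing.Theory Num.Theory.
Local Open Scope ring_scope.

Definition mx2 (K : nzRingType) (a b c d : K) : 'M[K]_2 :=
  \matrix_(i < 2, j < 2)
    if i == 0 then (if j == 0 then a else b) else (if j == 0 then c else d).

Section Pauli.
Variable R : realType.

Definition pauliX : 'M[R[i]]_2 := mx2 0 1 1 0.
Definition pauliY : 'M[R[i]]_2 := mx2 0 (- 'i) 'i 0.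
Definition pauliZ : 'M[R[i]]_2 := mx2 1 0 0 (- 1).

Inductive in_pauli : 'M[R[i]]_2 -> Prop :=
| in_pauliX : in_pauli pauliX
| in_pauliY : in_pauli pauliY
| in_pauliZ : in_pauli pauliZ
| in_pauli1 : in_pauli 1%:M
| in_pauliM A B of in_pauli A & in_pauli B : in_pauli (A *m B)
| in_pauliV A of in_pauli A : in_pauli (invmx A).

Record pauli := Pauli { pauli_mx :> 'M[R[i]]_2 ; _ : `[< in_pauli pauli_mx >] }.

HB.instance Definition _ := [isSub for pauli_mx].
HB.instance Definition _ := [Choice of pauli by <:].

Lemma pauliP (A : pauli) : in_pauli A.
Proof. by apply/asboolP; case: A. Qed.

Definition pauli_one : pauli := Pauli (asboolT in_pauli1).
Definition pauli_mul (A B : pauli) : pauli :=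
  Pauli (asboolT (in_pauliM (pauliP A) (pauliP B))).
Definition pauli_inv (A : pauli) : pauli :=
  Pauli (asboolT (in_pauliV (pauliP A))).

Lemma pauliXX : pauliX *m pauliX = 1%:M.
Proof.
apply/matrixP => i j; rewrite !mxE !big_ord_recr big_ord0 /= !mxE.
by case: i => [[|[|?]] ?] //; case: j => [[|[|?]] ?] //=;
  rewrite ?(mulr0, mul0r, mulr1, addr0, add0r).
Qed.

Lemma pauliYY : pauliY *m pauliY = 1%:M.
Proof.
apply/matrixP => i j; rewrite !mxE !big_ord_recr big_ord0 /= !mxE.
by case: i => [[|[|?]] ?] //; case: j => [[|[|?]] ?] //=;
  rewrite ?(mulNr, mulrN, mulr0, mul0r, addr0, add0r, oppr0) // -expr2 sqrCi opprK.
Qed.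

Lemma pauliZZ : pauliZ *m pauliZ = 1%:M.
Proof.
apply/matrixP => i j; rewrite !mxE !big_ord_recr big_ord0 /= !mxE.
by case: i => [[|[|?]] ?] //; case: j => [[|[|?]] ?] //=;
  rewrite ?(mulNr, mulrN, mulr0, mul0r, mulr1, addr0, add0r, oppr0, opprK).
Qed.

Lemma in_pauli_unit A : in_pauli A -> A \in unitmx.
Proof.
elim=> [||||B C _ uB _ uC|B _ uB].
- by have /mulmx1_unit[] := pauliXX.
- by have /mulmx1_unit[] := pauliYY.
- by have /mulmx1_unit[] := pauliZZ.
- exact: unitmx1.
- by rewrite unitmx_mul uB.
- by rewrite unitmx_inv.
Qed.

Let pauli_mulA : associative pauli_mul.
Proof. by move=> A B C; apply/val_inj; rewrite /= mulmxA. Qed.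

Let pauli_mul1 : left_id pauli_one pauli_mul.
Proof. by move=> A; apply/val_inj; rewrite /= mul1mx. Qed.

Let pauli_mulr1 : right_id pauli_one pauli_mul.
Proof. by move=> A; apply/val_inj; rewrite /= mulmx1. Qed.

Let pauli_mulV : left_inverse pauli_one pauli_inv pauli_mul.
Proof.
by move=> A; apply/val_inj; rewrite /= mulVmx// in_pauli_unit//; exact: pauliP.
Qed.

Let pauli_mulrV : right_inverse pauli_one pauli_inv pauli_mul.
Proof.
by move=> A; apply/val_inj; rewrite /= mulmxV// in_pauli_unit//; exact: pauliP.
Qed.

HB.instance Definition _ := isGroup.Build pauli
  pauli_mulA pauli_mul1 pauli_mulr1 pauli_mulV pauli_mulrV.

End Pauli.

Definition is_group_op (T : Type) (op : T -> T -> T) (e : T) (inv : T -> T) :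
    Prop :=
  [/\ associative op, left_id e op, right_id e op, left_inverse e inv op
    & right_inverse e inv op].

Definition op_isomorphic (T U : Type) (opT : T -> T -> T) (opU : U -> U -> U) :
    Prop :=
  exists2 f : T -> U, bijective f & {morph f : x y / opT x y >-> opU x y}.

Definition isometry (R : realType) (X : metricType R) (f : X -> X) : Prop :=
  forall x y : X, mdist (f x) (f y) = mdist x y.

(* The multiplications and inversions are the translations x |-> a * x and
   their inverses x |-> a^-1 * x.  The map x |-> x^-1 is not required to be an
   isometry: together with the left translations it would force the distance to
   be bi-invariant, and every bi-invariant distance on the Pauli group is also
   bi-invariant for an elementary abelian group operation on the same set. *)
Definition admits (R : realType) (X : metricType R) (op : X -> X -> X) : Prop :=
  exists (e : X) (inv : X -> X),
    is_group_op op e inv /\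
    forall a : X, isometry (op a) /\ isometry (op (inv a)).

Definition natural_group (R : realType) (G : groupType) : Prop :=
  exists (X : metricType R) (op : X -> X -> X),
    admits op /\ op_isomorphic op (fun x y : G => (x * y)%g).

(* Main.v *)
From HB Require Import structures.
Require Import Defs.
From mathcomp Require Import all_boot all_order all_algebra.
From mathcomp Require Import all_classical all_reals all_analysis.

(** A left-invariant distance on a group G has the form w (x^-1 * y) for a
    weight w which takes the same value at g and at g^-1; when the nontrivial
    weights all lie in [1, 2] the triangle inequality is automatic.  If t has a
    weight that no other element has, then x * t is the only point at distance
    w t from x, so every isometry commutes with right multiplication by t
    (isometry_mulr).

    Suppose that G is generated by a finite sequence of involutions.  Being
    their own inverses, these can be given weights of their own without
    breaking the symmetry of the distance.  Every isometry then commutes with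
    all right multiplications, hence is a left translation
    (isometry_translation).  The translations of a group operation op' that the
    metric space admits are isometries, so op' a x = op' a 1 * x, and
    a |-> op' a 1 is an isomorphism from op' onto the multiplication of G
    (admits_isomorphic).

    This applies to the Pauli group: X, Y and Z are involutions and generate it
    by definition. *)

Set Implicit Arguments.
Unset Strict Implicit.
Unset Printing Implicit Defensive.

Import Order.TTheory GRing.Theory Num.Theory.
Local Open Scope ring_scope.

Section InvolutionMetric.
Variables (R : realType) (G : groupType) (s : seq G).
Implicit Types x y g t : G.

Hypothesis s_invol : {in s, forall t, (t * t)%g = 1%g}.

(** All elements outside s have index size s, hence one common weight, whereas
    distinct elements of s have distinct weights; the reciprocals keep the
    nontrivial weights in [1, 2]. *)
Definition weight g : R :=
  if g == 1%g then 0 else 2 - (index g s).+1%:R^-1.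

Lemma weight_ge1 g : g != 1%g -> 1 <= weight g.
Proof.
move=> /negPf g1; rewrite /weight g1 lerBrDr -lerBrDl.
have -> : 2 - 1 = 1 :> R by rewrite -[2]/(1 + 1) addrK.
by rewrite invf_le1 ?ltr0n// ler1n.
Qed.

Lemma weight_ge0 g : 0 <= weight g.
Proof.
have [->|/weight_ge1] := eqVneq g 1%g; first by rewrite /weight eqxx.
exact: le_trans.
Qed.

Lemma weight_le2 g : weight g <= 2.
Proof.
rewrite /weight; case: eqP => // _.
by rewrite gerBl invr_ge0 ler0n.
Qed.

Lemma weight_eq0 g : weight g = 0 -> g = 1%g.
Proof.
move=> wg; apply/eqP; apply: contraT => /weight_ge1.
by rewrite wg ler10.
Qed.

Lemma invol_inv t : t \in s -> (t^-1)%g = t.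
Proof. by move=> /s_invol/mulg1_eq. Qed.

Lemma weightV g : weight (g^-1)%g = weight g.
Proof.
rewrite /weight invg_eq1.
have [gs|gNs] := boolP (g \in s); first by rewrite invol_inv.
have gVNs : (g^-1)%g \notin s.
  apply: contra gNs => gVs; have := invol_inv gVs.
  by rewrite invgK => ->.
by rewrite !memNindex.
Qed.

(** The case t = 1 is covered because only 1 has weight 0. *)
Lemma weight_inj_gen g t : t \in s -> weight g = weight t -> g = t.
Proof.
move=> ts; have [->|t1] := eqVneq t 1%g.
  by rewrite {2}/weight eqxx => /weight_eq0.
have [->|g1] := eqVneq g 1%g.
  by rewrite {1}/weight eqxx => /esym/weight_eq0.
rewrite /weight (negPf g1) (negPf t1) => /addrI/oppr_inj/invr_inj/eqP.
rewrite eqr_nat eqSS => /eqP gt.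
have gs : g \in s by rewrite -index_mem gt index_mem.
by rewrite -(nth_index t gs) gt nth_index.
Qed.

Let dist x y := weight (x^-1 * y)%g.

Let distxx x : dist x x = 0.
Proof. by rewrite /dist mulVg /weight eqxx. Qed.

Let dist_positivity x y : dist x y = 0 -> x = y.
Proof.
by move=> /weight_eq0/mulg1_eq; rewrite invgK.
Qed.

Let dist_sym x y : dist x y = dist y x.
Proof. by rewrite /dist -weightV invgM invgK. Qed.

Let dist_triangle y x z : dist x z <= dist x y + dist y z.
Proof.
have [->|xy] := eqVneq x y; first by rewrite distxx add0r.
have [->|yz] := eqVneq y z; first by rewrite distxx addr0.
have ge1 u v : u != v -> 1 <= dist u v.
  move=> uv; apply: weight_ge1; apply: contra uv => /eqP/mulg1_eq.
  by rewrite invgK => ->.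
apply: le_trans (weight_le2 _) _.
by rewrite -[2]/(1 + 1) lerD ?ge1.
Qed.

(** A copy of the carrier of G that holds the distance, so that G itself is
    not given a canonical topology. *)
Definition invol_space : Type := G.

HB.instance Definition _ := Choice.on invol_space.
HB.instance Definition _ :=
  isMetric.Build R invol_space distxx dist_positivity dist_sym dist_triangle.

Definition invol_op (x y : invol_space) : invol_space := (x * y : G)%g.

Lemma mdist_invol (x y : invol_space) :
  mdist x y = weight ((x : G)^-1 * y)%g.
Proof. by []. Qed.

Lemma isometry_invol_op (a : invol_space) : Defs.isometry (invol_op a).
Proof.
by move=> x y; rewrite !mdist_invol /invol_op invgM -mulgA mulKg.
Qed.

Lemma admits_invol_op : admits invol_op.
Proof.
exists (1%g : G), (fun x : G => x^-1)%g; split.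
  split=> [x y z|x|x|x|x]; rewrite /invol_op.
  - exact: mulgA.
  - exact: mul1g.
  - exact: mulg1.
  - exact: mulVg.
  - exact: mulgV.
by move=> a; split; exact: isometry_invol_op.
Qed.

Lemma isometry_mulr (f : invol_space -> invol_space) :
  Defs.isometry f -> {in s, forall t x, f (x * t : G)%g = (f x * t : G)%g}.
Proof.
move=> f_iso t ts x.
have := f_iso x (x * t : G)%g; rewrite !mdist_invol mulKg.
by move/(weight_inj_gen ts) => e; rewrite -[in RHS]e mulVKg.
Qed.

Hypothesis s_gen : forall P : G -> Prop,
  {in s, forall t, P t} -> P 1%g ->
  (forall x y, P x -> P y -> P (x * y)%g) -> (forall x, P x -> P (x^-1)%g) ->
  forall x, P x.

(** The elements whose right multiplication commutes with f form a subgroup,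
    which contains the generators. *)
Lemma isometry_translation (f : invol_space -> invol_space) :
  Defs.isometry f -> forall x, f x = (f (1%g : G) * x : G)%g.
Proof.
move=> f_iso y.
suff fM : forall z x : G, f (x * z : G)%g = (f x * z : G)%g.
  by rewrite -fM mul1g.
apply: s_gen => [t ts x|x|z1 z2 f1 f2 x|z fz x].
- exact: isometry_mulr.
- by rewrite !mulg1.
- by rewrite !mulgA f2 f1.
- by rewrite -[in RHS](mulgVK z x) fz mulgK.
Qed.

Lemma admits_isomorphic (op' : invol_space -> invol_space -> invol_space) :
  admits op' -> op_isomorphic op' invol_op.
Proof.
move=> [e [inv [[opA op1 opr1 opV opVr] op_iso]]].
have opE a x : op' a x = (op' a (1%g : G) * x : G)%g.
  by have [+ _] := op_iso a => /isometry_translation; apply.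
exists (op'^~ (1%g : G)); last first.
  by move=> a b /=; rewrite -opA opE.
(* The 1 here is that of G, not the unit e of op': op' a 1 = c exactly when
   a = op' c (inv 1). *)
exists (op'^~ (inv (1%g : G))) => c /=.
- by rewrite -opA opVr opr1.
- by rewrite -opA opV opr1.
Qed.

Lemma unique_group_op_invol :
  exists (X : metricType R) (op : X -> X -> X),
    [/\ admits op,
        op_isomorphic op (fun x y : G => (x * y)%g)
      & forall op' : X -> X -> X, admits op' -> op_isomorphic op' op].
Proof.
exists invol_space, invol_op; split.
- exact: admits_invol_op.
- by exists id => //; exists id.
- exact: admits_isomorphic.
Qed.

End InvolutionMetric.

Section PauliGenerators.
Variable R : realType.

Definition pauli_gens : seq (pauli R) :=
  [:: Pauli (asboolT (in_pauliX R)); Pauli (asboolT (in_pauliY R));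
      Pauli (asboolT (in_pauliZ R))].

Lemma pauli_gens_invol : {in pauli_gens, forall t, (t * t)%g = 1%g}.
Proof.
move=> t; rewrite !inE => /or3P[] /eqP ->; apply/val_inj => /=.
- exact: pauliXX.
- exact: pauliYY.
- exact: pauliZZ.
Qed.

Lemma pauli_gens_gen (P : pauli R -> Prop) :
  {in pauli_gens, forall t, P t} -> P 1%g ->
  (forall x y, P x -> P y -> P (x * y)%g) -> (forall x, P x -> P (x^-1)%g) ->
  forall x, P x.
Proof.
move=> Pgens P1 PM PV.
suff PA A : in_pauli A -> forall x : pauli R, val x = A -> P x.
  by move=> x; exact: PA (pauliP x) x erefl.
elim=> {A} [||||A B inA PA inB PB|A inA PA] x xE.
- rewrite (_ : x = Pauli (asboolT (in_pauliX R))); last exact/val_inj.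
  by apply: Pgens; rewrite !inE eqxx.
- rewrite (_ : x = Pauli (asboolT (in_pauliY R))); last exact/val_inj.
  by apply: Pgens; rewrite !inE eqxx orbT.
- rewrite (_ : x = Pauli (asboolT (in_pauliZ R))); last exact/val_inj.
  by apply: Pgens; rewrite !inE eqxx !orbT.
- by rewrite (_ : x = 1%g) //; apply/val_inj.
- rewrite (_ : x = Pauli (asboolT inA) * Pauli (asboolT inB))%g.
    by apply: PM; [exact: PA | exact: PB].
  exact/val_inj.
- rewrite (_ : x = (Pauli (asboolT inA))^-1)%g; first by apply: PV; exact: PA.
  exact/val_inj.
Qed.

End PauliGenerators.

Theorem lemma1 (R : realType) :
  natural_group R (pauli R) /\
  exists (X : metricType R) (op : X -> X -> X),
    [/\ admits op,
        op_isomorphic op (fun x y : pauli R => (x * y)%g)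
      & forall op' : X -> X -> X, admits op' -> op_isomorphic op' op].
Proof.
have [X [op [op_adm op_iso op_uniq]]] :=
  unique_group_op_invol R (@pauli_gens_invol R) (@pauli_gens_gen R).
by split; exists X, op.
Qed.
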